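(* Let $p$ be a prime, $S$ a finite $p$-group, and $\mathcal{G}\le\mathcal{F}$ two saturated fusion systems on $S$ (i.e. $\operatorname{Hom}_\mathcal{G}(P,Q)\subseteq\operatorname{Hom}_\mathcal{F}(P,Q)$ for all $P,Q\le S$). Suppose that $\operatorname{Hom}_\mathcal{G}(A,B)=\operatorname{Hom}_\mathcal{F}(A,B)$ for all subgroups $A,B\le S$ that are elementary abelian if $p$ is odd, and abelian of exponent at most $4$ if $p=2$. Then $\mathcal{G}=\mathcal{F}$.
   Context: Let $S$ be a finite $p$-group. A fusion system $\mathcal F$ on $S$ is a category whose objects are the subgroups of $S$ and whose morphism sets $\operatorname{Hom}_\mathcal F(P,Q)$ are sets of injective group homomorphisms $P\to Q$, such that (i) every homomorphism $P\to Q$ of the form $x\mapsto gxg^{-1}$ with $g\in S$ lies in $\operatorname{Hom}_\mathcal F(P,Q)$, and (ii) every $\varphi\in\operatorname{Hom}_\mathcal F(P,Q)$ factors as an isomorphism $P\to\varphi(P)$ in $\mathcal F$ whose inverse lies in $\mathcal F$, followed by the inclusion $\varphi(P)\le Q$; morphisms compose as functions. Write $\operatorname{Aut}_\mathcal F(P)=\operatorname{Hom}_\mathcal F(P,P)$ and $\operatorname{Aut}_S(P)$ for the automorphisms of $P$ induced by conjugation by elements of $N_S(P)$. Subgroups isomorphic in $\mathcal F$ are called $\mathcal F$-conjugate. $Q\le S$ is fully $\mathcal F$-normalized (resp. fully $\mathcal F$-centralized) if $|N_S(Q)|\ge|N_S(Q')|$ (resp. $|C_S(Q)|\ge|C_S(Q')|$)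 for all $\mathcal F$-conjugates $Q'$ of $Q$. For $\varphi\in\operatorname{Hom}_\mathcal F(Q,S)$ put $N_\varphi=\{g\in N_S(Q): \varphi\circ c_g|_Q\circ\varphi^{-1}\in\operatorname{Aut}_S(\varphi(Q))\}$, where $c_g(x)=gxg^{-1}$. $\mathcal F$ is saturated if (Sylow axiom) every fully $\mathcal F$-normalized $Q$ is fully $\mathcal F$-centralized and $\operatorname{Aut}_S(Q)$ is a Sylow $p$-subgroup of $\operatorname{Aut}_\mathcal F(Q)$, and (extension axiom) every $\varphi\in\operatorname{Hom}_\mathcal F(Q,S)$ with $\varphi(Q)$ fully $\mathcal F$-centralized extends to a morphism in $\operatorname{Hom}_\mathcal F(N_\varphi,S)$. *)

(* Defs.v *)
From HB Require Import structures.
From mathcomp Require Import all_boot all_fingroup all_solvable.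
Set Implicit Arguments. Unset Strict Implicit. Unset Printing Implicit Defensive.
Import GroupScope.
Local Open Scope group_scope.

Section Fusion.
Variable gT : finGroupType.

(* A morphism P -> Q is encoded as a finite function gT -> gT that is
   normalized to 1 outside its domain P. *)
Definition toff (P : {set gT}) (f : gT -> gT) : {ffun gT -> gT} :=
  [ffun x => if x \in P then f x else 1].

Definition is_inj_hom (P Q : {set gT}) (f : {ffun gT -> gT}) : Prop :=
  [/\ f = toff P f, {in P &, {morph f : x y / x * y}},
      {in P &, injective f} & f @: P \subset Q].

(* A "hom-set assignment" F P Q = Hom_F(P,Q); only values on subgroups
   of S matter. *)
Definition homs := {set gT} -> {set gT} -> {set {ffun gT -> gT}}.

(* conjugation map x |-> x ^ g (MathComp: g^-1 x g); as g ranges over S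
   this gives the same maps as x |-> g x g^-1. *)
Definition cmap (P : {set gT}) (g : gT) := toff P (fun x => x ^ g).

Definition is_fusion_system (S : {group gT}) (F : homs) : Prop :=
  [/\ (forall P Q : {group gT}, P \subset S -> Q \subset S ->
         forall f, f \in F P Q -> is_inj_hom P Q f),
      (forall (P Q : {group gT}) g, P \subset S -> Q \subset S -> g \in S ->
         P :^ g \subset Q -> cmap P g \in F P Q),
      (forall P Q : {group gT}, P \subset S -> Q \subset S ->
         forall f, f \in F P Q ->
           f \in F P (f @: P) /\
           exists2 h, h \in F (f @: P) P &
             {in P, forall x, h (f x) = x} /\ {in f @: P, forall y, f (h y) = y})
    &
      (forall P Q R : {group gT}, P \subset S -> Q \subset S -> R \subset S ->
         forall f h, f \in F P Q -> h \in F Q R ->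
           toff P (fun x => h (f x)) \in F P R)].

Definition fconj (F : homs) (P P' : {set gT}) : Prop :=
  exists2 f, f \in F P P' & exists2 h, h \in F P' P &
    {in P, forall x, h (f x) = x} /\ {in P', forall y, f (h y) = y}.

Definition fully_normalized (S : {group gT}) (F : homs) (Q : {set gT}) :=
  forall Q' : {group gT}, Q' \subset S -> fconj F Q Q' ->
    #|'N_S(Q')| <= #|'N_S(Q)|.

Definition fully_centralized (S : {group gT}) (F : homs) (Q : {set gT}) :=
  forall Q' : {group gT}, Q' \subset S -> fconj F Q Q' ->
    #|'C_S(Q')| <= #|'C_S(Q)|.

Definition AutF (F : homs) (Q : {set gT}) : {set {perm gT}} :=
  [set a in Aut Q | toff Q a \in F Q Q].

Definition AutS (S : {group gT}) (Q : {set gT}) : {set {perm gT}} :=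
  [set a in Aut Q | [exists g in 'N_S(Q), [forall x in Q, a x == x ^ g]]].

Definition Nphi (S : {group gT}) (Q : {set gT}) (f : {ffun gT -> gT}) :=
  [set g in 'N_S(Q) | [exists h in 'N_S(f @: Q),
     [forall x in Q, f (x ^ g) == (f x) ^ h]]].

Definition saturated (p : nat) (S : {group gT}) (F : homs) : Prop :=
  (forall Q : {group gT}, Q \subset S -> fully_normalized S F Q ->
     fully_centralized S F Q /\ p.-Sylow(AutF F Q) (AutS S Q)) /\
  (forall Q : {group gT}, Q \subset S -> forall f, f \in F Q S ->
     fully_centralized S F (f @: Q) ->
     exists2 h, h \in F (Nphi S Q f) S & {in Q, forall x, h x = f x}).

Definition saturated_fusion_system p S F :=
  is_fusion_system S F /\ saturated p S F.

End Fusion.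

(* Main.v *)
(* By downward induction on [#|P|] it is enough to treat a fully F-normalized P.
   Choose A <| P abelian of small exponent such that every p'-automorphism of P
   trivial on A is trivial, and a G-morphism chi : N_S(A) -> S whose image
   B = chi(A) is fully G-normalized. Every F-morphism on A is in G, so the
   extension axiom of G shows that any F-morphism on P becomes equal to chi on A
   after composition with a G-morphism; let phi be one with phi = chi on A. Then
   phi(P) C_S(B) = chi(P) C_S(B).
   If C_S(B) <= chi(P), then chi^-1 phi is an automorphism of P in the p-group
   C_{Aut_F(P)}(A); comparing with a Sylow subgroup Aut_S(P), it is inner, since
   an element of N_S(P) outside P centralizing a conjugate of A would be carried
   to an element of C_S(B) outside chi(P).
   Otherwise some element of C_S(B) outside phi(P) normalizes phi(P), and both
   phi and chi become, modulo G, automorphisms of P that conjugate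
   C_{Aut_F(P)}(A) to p-groups meeting Aut_S(P) outside Inn(P). By induction
   Aut_G(P) is strongly p-embedded in Aut_F(P) modulo Inn(P), so these two
   automorphisms differ by an element of Aut_G(P). *)

Require Import Defs.
From HB Require Import structures.
From mathcomp Require Import all_boot all_fingroup all_solvable.
Import GroupScope.

Set Implicit Arguments.
Unset Strict Implicit.
Unset Printing Implicit Defensive.

(** * Automorphisms of p-groups *)

Section CoprimeAutomorphisms.

Variables (gT : finGroupType) (p : nat).
Implicit Types (P K D A : {group gT}) (a : {perm gT}).

Lemma Aut_morphM P a x y :
  a \in Aut P -> x \in P -> y \in P -> a (x * y) = a x * a y.
Proof. by move=> /Aut_morphic /morphicP aM xP yP; rewrite aM. Qed.

Lemma Aut_morphX P a x n : a \in Aut P -> x \in P -> a (x ^+ n) = a x ^+ n.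
Proof.
move=> aP xP; have := morphX (autm_morphism aP) n xP.
by rewrite /= !autmE.
Qed.

Lemma Aut_morphR P a x y :
  a \in Aut P -> x \in P -> y \in P -> a [~ x, y] = [~ a x, a y].
Proof.
move=> aP xP yP; have := morphR (autm_morphism aP) xP yP.
by rewrite /= !autmE.
Qed.

(* If [a] fixes [c = x^-1 * a x], then [a^k x = x * c ^+ k] for all [k], so the
   order of [c] divides the coprime integers [#[a]] and [#[c]]. *)
Lemma coprime_Aut_fix P a x :
  p.-group P -> a \in Aut P -> p^'.-elt a -> x \in P ->
  a (x^-1 * a x) = x^-1 * a x -> a x = x.
Proof.
move=> pP aP p'a xP; set c := x^-1 * a x => ac.
have axP : a x \in P by rewrite Aut_closed.
have cP : c \in P by rewrite groupM ?groupV.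
have ax : a x = x * c by rewrite mulKVg.
clearbody c.
have akx k : (a ^+ k) x = x * c ^+ k.
  elim: k => [|k IHk]; first by rewrite perm1 mulg1.
  rewrite expgSr permM IHk (Aut_morphM aP) ?groupX //.
  by rewrite (Aut_morphX _ aP) // ac ax expgS mulgA.
have c_a : c ^+ #[a] = 1.
  by apply: (mulgI x); rewrite -akx expg_order perm1 mulg1.
suff c1 : c = 1 by rewrite ax c1 mulg1.
apply/eqP; rewrite -order_eq1 -dvdn1 -(@Gauss_dvdl _ _ #[a]).
  by rewrite mul1n order_dvdn c_a.
exact: pnat_coprime (mem_p_elt pP cP) p'a.
Qed.

(** The value 4 at [p = 2] makes [p] divide ['C(small_exp, 2)], which fails for exponent 2. *)
Definition small_exp := if p == 2 then 4 else p.

Lemma small_expE : prime p -> small_exp = (p ^ (p == 2).+1)%N.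
Proof. by move=> p_pr; rewrite /small_exp; case: eqP => // ->. Qed.

Lemma dvdn_small_exp : prime p -> p %| small_exp.
Proof. by move=> p_pr; rewrite small_expE // expnS dvdn_mulr. Qed.

Lemma dvdn_bin_small_exp : prime p -> p %| 'C(small_exp, 2).
Proof.
rewrite /small_exp; case: eqP => [-> //|/eqP p2] p_pr.
by apply: prime_dvd_bin => //=; rewrite ltn_neqAle eq_sym p2 prime_gt1.
Qed.

(* With [K] a critical subgroup of [P] and [D] the subgroup of its elements of
   order dividing [small_exp], take [A] maximal abelian in [D]: a p'-automorphism
   trivial on [A] is successively trivial on [D], ['Z(K)], [K] and [P]. *)
Lemma exists_small_abelian_normal P : prime p -> p.-group P ->
  exists A : {group gT}, [/\ A <| P,
    if p == 2 then abelian A && (exponent A <= 4) else p.-abelem A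
    & forall a, a \in Aut P -> p^'.-elt a -> {in A, forall x, a x = x} ->
        a = 1].
Proof.
move=> p_pr pP; have [K critK] := Thompson_critical pP.
have [charK sPhiZ sRZ _] := critK.
have sKP := char_sub charK; have nKP := char_norm charK.
have cZ z x : z \in 'Z(K) -> x \in K -> commute x z.
  by move=> /centerP[_ zC] /zC.
have pwZ x : x \in K -> x ^+ p \in 'Z(K).
  move=> xK; apply: (subsetP sPhiZ).
  rewrite (Phi_joing (pgroupS sKP pP)) mem_gen // inE; apply/orP; right.
  rewrite -[p in _ ^+ p]expn1 Mho_p_elt //.
  exact: mem_p_elt pP (subsetP sKP _ xK).
have RZ x y : x \in P -> y \in K -> [~ x, y] \in 'Z(K).
  by move=> xP yK; rewrite (subsetP sRZ) ?mem_commg.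
have RZ' x y : y \in P -> x \in K -> [~ x, y] \in 'Z(K).
  by move=> yP xK; rewrite -invg_comm groupV RZ.
have KP x : x \in K -> x \in P by apply: (subsetP sKP).
have Rp x y : x \in K -> y \in K -> [~ x, y] ^+ p = 1.
  move=> xK yK; have Rxy : [~ x, y] \in 'Z(K) by rewrite RZ ?KP.
  rewrite -commXg; last by apply: (cZ).
  by apply/eqP/commgP; apply/commute_sym/(cZ) => //; apply: pwZ.
set q := small_exp.
have pq : p %| q by apply: dvdn_small_exp.
(* Commutators of [K] are central, so the defect of the power map is [[~ y, x] ^+ 'C(q, 2)]. It is
   trivial because these commutators have order dividing [p]. *)
have expq x y : x \in K -> y \in K -> (x * y) ^+ q = x ^+ q * y ^+ q.
  move=> xK yK; rewrite expMg_Rmul; try by apply: (cZ) => //; rewrite RZ ?KP.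
  have /dvdnP[m ->] := dvdn_bin_small_exp p_pr.
  by rewrite mulnC expgM Rp // expg1n mulg1.
pose D := [set x in K | x ^+ q == 1].
have gD : group_set D.
  apply/group_setP; split=> [|x y]; first by rewrite inE group1 expg1n eqxx.
  rewrite !inE => /andP[xK /eqP xq] /andP[yK /eqP yq].
  by rewrite groupM //= expq // xq yq mulg1.
have sDK x : x \in D -> x \in K by rewrite inE => /andP[].
have D_J x y : x \in D -> y \in P -> x ^ y \in D.
  rewrite !inE => /andP[xK /eqP xq] yP.
  by rewrite memJ_norm ?(subsetP nKP) // xK -conjXg xq conj1g eqxx.
have D_R x y : x \in D -> y \in P -> [~ x, y] \in D.
  move=> xD yP; rewrite commgEl.
  have xVD : x^-1 \in D by exact: (groupVr (G := Group gD)).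
  exact: (groupM (G := Group gD) xVD (D_J _ _ xD yP)).
have [|A /maxgroupP[/andP[sAD cAA] maxA] _] :=
    @maxgroup_exists _ (fun B => (B \subset D) && abelian B) 1%G.
  by rewrite /= abelian1 sub1set (group1 (Group gD)).
have AD x : x \in A -> x \in D by apply: (subsetP sAD).
have maxD x : x \in D -> (forall y, y \in A -> commute x y) -> x \in A.
  move=> xD cxA; rewrite -(maxA (A <*> <[x]>)%G) ?joing_subl //.
    by rewrite mem_gen // inE cycle_id orbT.
  rewrite /= (@join_subG _ A <[x]>%G (Group gD)) sAD /=.
  rewrite (@cycle_subG _ x (Group gD)) xD.
  rewrite /= abelianY cAA.
  rewrite cycle_abelian cycle_subG; apply/centP=> y yA; exact: cxA.
exists A; split.
- apply/normalP; split=> [|y yP]; first by apply/subsetP=> x /AD /sDK /KP.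
  apply/normP; rewrite (subsetP _ _ yP) //; apply/subsetP=> z zP.
  rewrite inE; apply/subsetP=> _ /imsetP[x xA ->].
  rewrite -[x ^ z]mul1g -(mulgV x) -mulgA groupM // -commgEl.
  apply: (maxD) => [|u uA]; first by apply: D_R => //; apply: AD.
  by apply/commute_sym/(cZ); [apply: RZ' => // | ]; apply/sDK/AD.
- have expA x : x \in A -> x ^+ q = 1 by move/AD; rewrite inE => /andP[_ /eqP].
  move: expA; rewrite /q /small_exp; case: eqP => [_|/eqP p2] expA; last first.
    by apply/(abelemP p_pr).
  rewrite cAA dvdn_leq //; exact/exponentP.
move=> a aP p'a aA.
have a1 : a 1 = 1 by rewrite -(autmE aP) morph1.
have aK x : x \in K -> a x \in K.
  move: charK => /andP[_ /forall_inP/(_ a aP) /subsetP aKK] xK.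
  exact/aKK/imset_f.
have aD x : x \in D -> a x \in D.
  rewrite inE => /andP[xK /eqP xq].
  by rewrite inE aK //= -(Aut_morphX _ aP) ?KP // xq a1.
have fixP x : x \in P -> a (x^-1 * a x) = x^-1 * a x -> a x = x.
  exact: coprime_Aut_fix.
(* Put [c = x^-1 * a x]. For [g] in [A], the commutator [[~ x, g]] is in [D] and central in [K],
   hence in [A] by maximality and fixed by [a]. Comparing it with [[~ x * c, g]] gives [[~ c, g] =
   1], so [c] is in [A] and [coprime_Aut_fix] applies. *)
have fixD x : x \in D -> a x = x.
  move=> xD; apply: (fixP); first exact/KP/sDK.
  have cD : x^-1 * a x \in D.
    have xVD : x^-1 \in D by exact: (groupVr (G := Group gD)).
    exact: (groupM (G := Group gD) xVD (aD _ xD)).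
  apply: (aA); apply: (maxD) => // g gA.
  have [xK gK] := (sDK _ xD, sDK _ (AD _ gA)).
  have RxgA : [~ x, g] \in A.
    apply: (maxD) => [|u uA]; first by apply: D_R; rewrite ?KP.
    by apply/commute_sym/(cZ); [apply: RZ'; rewrite ?KP | apply/sDK/AD].
  have RxgZ : [~ x, g] \in 'Z(K) by rewrite RZ ?KP.
  have ax : a x = x * (x^-1 * a x) by rewrite mulKVg.
  move: (x^-1 * a x) cD ax => c cD ax.
  have := aA _ RxgA; rewrite (Aut_morphR aP) ?KP // (aA _ gA) ax.
  rewrite commMgJ conjgE -(cZ _ _ RxgZ (sDK _ cD)) => /eqP.
  by rewrite mulKg -[X in _ == X]mulg1 (inj_eq (mulgI _)) => /commgP.
have fixc x : x \in K -> x ^+ q = 1 -> a x = x.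
  by move=> xK /eqP xq; apply: fixD; rewrite inE xK.
(* By induction [x ^+ p] is fixed, so [x^-1 * a x] has order dividing [p] and lies in [D]. *)
have fixZ n x : x \in 'Z(K) -> x ^+ (p ^ n) = 1 -> a x = x.
  elim: n x => [|n IHn] x xZ; first by rewrite expg1 => ->; rewrite a1.
  have xK : x \in K by case/centerP: xZ.
  rewrite expnS expgM => /IHn xp; apply: (fixP); first exact: KP.
  apply: (fixc); first by rewrite groupM ?groupV ?aK.
  suff cp : (x^-1 * a x) ^+ p = 1.
    by have /dvdnP[m ->] := pq; rewrite mulnC expgM cp expg1n.
  rewrite expgMn; last first.
    by apply: commute_sym; apply: (cZ); rewrite ?groupV ?aK.
  by rewrite -(Aut_morphX _ aP) ?KP // xp ?groupX // expgVn mulVg.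
(* Here [x ^+ q] is in ['Z(K)], hence fixed, so [x^-1 * a x] has trivial [q]-th power and again lies
   in [D]. *)
have fixK x : x \in K -> a x = x.
  move=> xK; apply: (fixP); first exact: KP.
  have axK := aK _ xK.
  apply: (fixc); first by rewrite groupM ?groupV.
  rewrite expq ?groupV // -(Aut_morphX _ aP) ?KP //.
  suff -> : a (x ^+ q) = x ^+ q by rewrite expgVn mulVg.
  have xpZ := pwZ _ xK.
  have /p_natP[n Dn] := mem_p_elt pP (KP _ xK).
  apply: (fixZ n).
    by have /dvdnP[m ->] := pq; rewrite mulnC expgM groupX.
  by rewrite -expgM mulnC expgM -Dn expg_order expg1n.
have aC : a \in 'C(K | [Aut P]).
  by rewrite astab_ract inE aP; apply/astabP=> x /fixK.
apply/eqP; rewrite -order_eq1; apply/eqP/(@pnat_1 p) => //.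
exact: mem_p_elt (critical_p_stab_Aut critK pP) aC.
Qed.

End CoprimeAutomorphisms.

(* [H] is strongly [p]-embedded in [L] modulo [I], the [p]-elements of [I]
   playing the role of the trivial ones. *)
Section StronglyEmbedded.

Variables (aT : finGroupType) (p : nat) (L H T I : {group aT}).
Hypotheses (sHL : H \subset L) (sTH : T \subset H) (sylT : p.-Sylow(L) T).
Hypothesis nIH : H \subset 'N(I).
Hypothesis embed : forall u a, u \in T -> u \notin I -> a \in L ->
  u ^ a \in T -> a \in H.

(** By Sylow's theorem in [H], both [u] and [u ^ a] are [H]-conjugate into [T]; changing [a] by
    elements of [H] on both sides reduces to [embed]. *)
Lemma embed_p_elt u a : p.-elt u -> u \in H -> u \notin I -> a \in L ->
  u ^ a \in H -> a \in H.
Proof.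
move=> pu uH uI aL uaH.
have sylTH : p.-Sylow(H) T := pHall_subl sTH sHL sylT.
have into_T v : p.-elt v -> v \in H -> exists2 h, h \in H & v ^ h \in T.
  move=> pv vH; have [||h hH] := Sylow_Jsub sylTH (_ : <[v]> \subset H).
  - by rewrite cycle_subG.
  - by [].
  by rewrite /= -cycleJ cycle_subG => vhT; exists h.
have [h1 h1H uT] := into_T u pu uH.
have [|h2 h2H uaT] := into_T (u ^ a) _ uaH; first by rewrite p_eltJ.
have : h1^-1 * a * h2 \in H.
  apply: (embed uT).
  - by rewrite memJ_norm // (subsetP nIH).
  - by rewrite !groupM ?groupV ?(subsetP sHL _ h1H) ?(subsetP sHL _ h2H).
  by rewrite -conjgM !mulgA mulgV mul1g conjgM.
by rewrite groupMr // groupMl ?groupV.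
Qed.

(** Otherwise normalizers grow in [X]: some [a] in [X] outside [H] normalizes [X :&: H], so [u] and
    [u ^ a] are both in [H], against [embed_p_elt]. *)
Lemma embed_pgroup (X : {group aT}) u : X \subset L -> p.-group X ->
  u \in X -> u \in H -> u \notin I -> X \subset H.
Proof.
move=> sXL pX uX uH uI; apply/setIidPl; apply: contraNeq uI => ne_XH.
have/properP[_ [a /setIP[aX aN] a'H]]: X :&: H \proper 'N_X(X :&: H).
  by rewrite (nilpotent_proper_norm (pgroup_nil pX)) // properEneq ne_XH subsetIl.
apply: contraR a'H => uI; rewrite inE aX.
apply: (embed_p_elt (mem_p_elt pX uX) uH uI); first exact: (subsetP sXL).
have : u ^ a \in X :&: H by rewrite memJ_norm // inE uX.
by case/setIP.
Qed.

(** The element [u2] forces [X :^ a2] into [H]. Then [a1^-1 * a2] carries [u1] into [X :^ a2], hence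
    into [H]. *)
Lemma embed_conj (X : {group aT}) a1 a2 u1 u2 : X \subset L -> p.-group X ->
  a1 \in L -> a2 \in L -> u1 \in T -> u1 \notin I -> u2 \in T -> u2 \notin I ->
  u1 \in X :^ a1 -> u2 \in X :^ a2 -> a1^-1 * a2 \in H.
Proof.
move=> sXL pX a1L a2L u1T u1I u2T u2I u1X u2X.
have sTH' := subsetP sTH.
have sX1L : (X :^ a2)%G \subset L by rewrite /= -(conjGid a2L) conjSg.
have sX2H : (X :^ a2)%G \subset H.
  by apply: (embed_pgroup _ _ u2X); rewrite ?pgroupJ ?sTH'.
apply: (embed_p_elt _ (sTH' _ u1T) u1I); last 2 first.
- by rewrite groupM ?groupV.
- by apply: (subsetP sX2H); rewrite conjgM /= memJ_conjg -mem_conjg.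
exact: mem_p_elt (pHall_pgroup sylT) u1T.
Qed.

End StronglyEmbedded.

(** * Fusion systems *)

Section Toff.

Variable gT : finGroupType.
Implicit Types N P Q R : {group gT}.

Lemma toffE (P : {set gT}) f x : x \in P -> toff P f x = f x.
Proof. by move=> xP; rewrite ffunE xP. Qed.

Lemma eq_toff (P : {set gT}) f g : {in P, f =1 g} -> toff P f = toff P g.
Proof. by move=> fg; apply/ffunP=> x; rewrite !ffunE; case: ifP => // /fg. Qed.

Lemma imset_toff (P : {set gT}) f : toff P f @: P = f @: P.
Proof. by apply: eq_in_imset => x xP; rewrite toffE. Qed.

(* The restriction of the total function [f] to [P] is in [Hom_F(P, S)]; the
   values of [f] outside [P] are irrelevant. *)
Definition mor (S : {group gT}) (F : homs gT) (P : {set gT}) (f : gT -> gT) :=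
  toff P f \in F P S.

Lemma mor_eq S F P f g : {in P, f =1 g} -> mor S F P f -> mor S F P g.
Proof. by move=> /eq_toff; rewrite /mor => ->. Qed.

End Toff.

Section FusionSystem.

Variables (gT : finGroupType) (S : {group gT}) (F : homs gT).
Hypothesis fsF : is_fusion_system S F.
Implicit Types N P Q R : {group gT}.

Local Notation mor := (mor S F).

(** Factor [f] through its image, then compose with an inclusion, which is conjugation by 1. *)
Lemma hom_cod P Q R f : P \subset S -> Q \subset S -> R \subset S ->
  toff P f \in F P Q -> f @: P \subset R -> toff P f \in F P R.
Proof.
have [injF _ isoF compF] := fsF.
move=> sPS sQS sRS fF sfR.
have [fFi _] := isoF P Q sPS sQS _ fF.
have [_ fM _ sfQ] := injF P Q sPS sQS _ fF.
have gI : group_set (toff P f @: P).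
  rewrite -[_ @: P](morphimEdom (Morphism fM)); exact: groupP.
pose I := Group gI; have sIR : I \subset R by rewrite /= imset_toff.
have sIS : I \subset S := subset_trans sIR sRS.
have incI : cmap I 1 \in F I R.
  have [_ conjF _ _] := fsF.
  by apply: conjF; rewrite ?conjsg1.
have := compF P I R sPS sIS sRS _ _ fFi incI.
rewrite -(@eq_toff _ P f) // => x xP; rewrite (toffE _ xP).
by rewrite toffE ?conjg1 //= imset_toff imset_f.
Qed.

Lemma mor_spec P f : P \subset S -> mor P f ->
  [/\ {in P &, {morph f : x y / x * y}}, {in P &, injective f} & f @: P \subset S].
Proof.
have [injF _ _ _] := fsF; move=> sPS /(injF P S sPS (subxx _))[_ fM fI].
rewrite imset_toff => sfS; split=> // x y xP yP.
  by have := fM x y xP yP; rewrite !toffE ?groupM.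
by have := fI x y xP yP; rewrite !toffE.
Qed.

Lemma mor_im P f : P \subset S -> mor P f ->
  exists Q : {group gT}, [/\ f @: P = Q, Q \subset S & #|Q| = #|P|].
Proof.
move=> sPS /(mor_spec sPS)[fM fI sfS].
exists (Morphism fM @* P)%G; rewrite /= morphimEdom; split=> //.
exact: card_in_imset.
Qed.

Lemma mor_res P R f : P \subset S -> R \subset P -> mor P f -> mor R f.
Proof.
have [_ conjF _ compF] := fsF; move=> sPS sRP fF.
have sRS := subset_trans sRP sPS.
have incR : cmap R 1 \in F R P by apply: conjF; rewrite ?conjsg1.
have := compF R P S sRS sPS (subxx _) _ _ incR fF.
rewrite /mor -(@eq_toff _ R f) // => x xR.
by rewrite (toffE _ xR) conjg1 toffE // (subsetP sRP).
Qed.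

Lemma mor_comp P Q f h : P \subset S -> Q \subset S ->
  mor P f -> f @: P \subset Q -> mor Q h -> mor P (h \o f).
Proof.
have [_ _ _ compF] := fsF; move=> sPS sQS fF sfQ hF.
have := compF P Q S sPS sQS (subxx _) _ _ (hom_cod sPS (subxx _) sQS fF sfQ) hF.
rewrite /mor -(@eq_toff _ P (h \o f)) // => x xP.
by rewrite (toffE _ xP) toffE // (subsetP sfQ) ?imset_f.
Qed.

Lemma mor_conj P g : P \subset S -> g \in S -> mor P (conjg^~ g).
Proof.
have [_ conjF _ _] := fsF; move=> sPS gS; apply: conjF => //.
by rewrite -(conjGid gS) conjSg.
Qed.

Lemma mor_id P : P \subset S -> mor P id.
Proof.
by move=> sPS; apply: mor_eq (mor_conj sPS (group1 S)) => x _; rewrite conjg1.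
Qed.

Lemma mor_inv P Q f : P \subset S -> Q \subset S -> mor P f -> f @: P = Q ->
  exists h, [/\ mor Q h, h @: Q = P, {in P, cancel f h} & {in Q, cancel h f}].
Proof.
have [injF _ isoF _] := fsF; move=> sPS sQS fF fPQ.
have [_ [h]] := isoF P S sPS (subxx _) _ fF.
rewrite imset_toff fPQ => hF [fK hK].
have [hE _ _ shP] := injF Q P sQS sPS _ hF.
have fhK : {in P, cancel f h} by move=> x xP; rewrite -{2}(fK x xP) toffE.
have hh : h @: Q = P.
  apply/eqP; rewrite eqEsubset shP; apply/subsetP=> x xP.
  by rewrite -(fhK x xP) imset_f // -fPQ imset_f.
exists h; split=> //.
  rewrite hE in hF; apply: hom_cod hF _ => //; exact: subset_trans shP sPS.
move=> y yQ; rewrite -{2}(hK y yQ) toffE //.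
by rewrite -hh imset_f.
Qed.

(** On [P], [f] is [h \o f] followed by the inverse of [h] restricted to [f @: P]. *)
Lemma mor_cancel P N f h : P \subset S -> N \subset S -> mor N h ->
  {in P &, {morph f : x y / x * y}} ->
  f @: P \subset N -> mor P (h \o f) -> mor P f.
Proof.
move=> sPS sNS hN fM sfN hfP.
pose Q := (Morphism fM @* P)%G; have EQ : f @: P = Q by rewrite /= morphimEdom.
have sQN : Q \subset N by rewrite -EQ.
have sQS := subset_trans sQN sNS.
have hQ := mor_res sNS sQN hN.
have [R [hR sRS _]] := mor_im sQS hQ.
have [g [gR _ hK _]] := mor_inv sQS sRS hQ hR.
apply: mor_eq (mor_comp sPS sRS hfP _ gR).
  by move=> x xP /=; rewrite hK // -EQ imset_f.
by rewrite imset_comp EQ hR.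
Qed.

Lemma mor_fconj P Q : P \subset S -> Q \subset S -> fconj F P Q ->
  exists2 f, mor P f & f @: P = Q.
Proof.
have [injF _ _ _] := fsF; move=> sPS sQS [f fF [h hF [fK hK]]].
have [Ef _ _ sfQ] := injF P Q sPS sQS _ fF.
have [_ _ _ shP] := injF Q P sQS sPS _ hF.
exists f; first by rewrite Ef in fF; apply: hom_cod fF _; rewrite ?(subset_trans sfQ).
apply/eqP; rewrite eqEsubset sfQ; apply/subsetP=> y yQ.
by rewrite -(hK y yQ) imset_f // (subsetP shP) ?imset_f.
Qed.

End FusionSystem.

(** * Automizers in [S] and in a fusion system *)

Section Automizers.

Variables (gT : finGroupType) (S : {group gT}).
Implicit Types P Q : {group gT}.

Lemma AutSP Q a :
  reflect (a \in Aut Q /\ exists2 g, g \in 'N_S(Q) & {in Q, forall x, a x = x ^ g})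
          (a \in AutS S Q).
Proof.
rewrite [a \in AutS _ _]inE; apply: (iffP andP) => [[aQ /exists_inP[g gN /forall_inP aE]]|].
  by split=> //; exists g => // x /aE/eqP.
move=> [aQ [g gN aE]]; split=> //; apply/exists_inP; exists g => //.
by apply/forall_inP=> x /aE/eqP.
Qed.

Lemma imset_Aut Q a : a \in Aut Q -> a @: Q = Q.
Proof.
move=> aQ; apply/eqP; rewrite eqEcard card_imset ?leqnn ?andbT; last exact: perm_inj.
by apply/subsetP=> _ /imsetP[x xQ ->]; rewrite Aut_closed.
Qed.

Lemma group_set_AutS Q : group_set (AutS S Q).
Proof.
apply/group_setP; split.
  by apply/AutSP; split=> //; exists 1 => // x _; rewrite perm1 conjg1.
move=> a b /AutSP[aQ [g gN aE]] /AutSP[bQ [h hN bE]]; apply/AutSP.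
split; first exact: groupM.
exists (g * h) => [|x xQ]; first exact: groupM.
by rewrite permM aE // bE ?conjgM // memJ_norm //; case/setIP: gN.
Qed.

Canonical AutS_group Q := Group (group_set_AutS Q).

Lemma conj_aut_AutS Q g : g \in 'N_S(Q) -> conj_aut Q g \in AutS S Q.
Proof.
move=> gN; apply/AutSP; split; first exact: Aut_aut.
by exists g => // x xQ; rewrite norm_conj_autE //; case/setIP: gN.
Qed.

End Automizers.

Section AutF.

Variables (gT : finGroupType) (S : {group gT}) (F : homs gT).
Hypothesis fsF : is_fusion_system S F.
Implicit Types N P Q R : {group gT}.

Local Notation mor := (mor S F).

Lemma AutFP Q a : Q \subset S ->
  reflect (a \in Aut Q /\ mor Q a) (a \in AutF F Q).
Proof.
move=> sQS; rewrite [a \in AutF _ _]inE; apply: (iffP andP) => [][aQ aF]; split=> //.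
  apply: (hom_cod fsF) aF _ => //; apply: subset_trans sQS.
  by apply/subsetP=> _ /imsetP[x xQ ->]; rewrite Aut_closed.
apply: (hom_cod fsF) aF _ => //.
by apply/subsetP=> _ /imsetP[x xQ ->]; rewrite Aut_closed.
Qed.

Lemma group_set_AutF Q : Q \subset S -> group_set (AutF F Q).
Proof.
move=> sQS; apply/group_setP; split.
  apply/AutFP=> //; split; first exact: group1.
  by apply: mor_eq (mor_id fsF sQS) => x _; rewrite perm1.
move=> a b /(AutFP _ sQS)[aQ aF] /(AutFP _ sQS)[bQ bF]; apply/AutFP => //.
split; first exact: groupM.
apply: mor_eq (mor_comp fsF sQS sQS aF _ bF) => [x _|].
  by rewrite permM.
by apply/subsetP=> _ /imsetP[x xQ ->]; rewrite Aut_closed.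
Qed.

Lemma mor_perm Q f : Q \subset S -> mor Q f -> f @: Q = Q ->
  exists2 a, a \in AutF F Q & {in Q, a =1 f}.
Proof.
move=> sQS fF fQ; have [fM fI _] := mor_spec fsF sQS fF.
have sfQ : f @: Q \subset Q by rewrite fQ.
pose a := perm_in fI sfQ.
have aE : {in Q, a =1 f} by move=> x xQ; rewrite perm_inE.
exists a => //; apply/AutFP => //; split; last by apply: mor_eq fF => x /aE.
rewrite inE perm_in_on; apply/morphicP=> x y xQ yQ.
by rewrite !aE ?groupM ?fM.
Qed.

Lemma AutS_sub_AutF Q : Q \subset S -> AutS S Q \subset AutF F Q.
Proof.
move=> sQS; apply/subsetP=> a /AutSP[aQ [g /setIP[gS gN] aE]].
apply/AutFP => //; split=> //.
by apply: mor_eq (mor_conj fsF sQS gS) => x /aE.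
Qed.

Lemma fconj_trans_mor P Q R f : P \subset S -> Q \subset S -> R \subset S ->
  mor P f -> f @: P = Q -> fconj F Q R -> exists2 g, mor P g & g @: P = R.
Proof.
move=> sPS sQS sRS fF fPQ /(mor_fconj fsF sQS sRS)[g gF gQR].
exists (g \o f); last by rewrite imset_comp fPQ.
by apply: (mor_comp fsF sPS sQS) => //; rewrite fPQ.
Qed.

Lemma exists_fully_normalized P : P \subset S ->
  exists f Q, [/\ Q \subset S, mor P f, f @: P = Q & fully_normalized S F Q].
Proof.
move=> sPS.
pose C Q := (Q \subset S) && [exists f, (f \in F P S) && (f @: P == Q)].
have CP : C P.
  rewrite /C sPS; apply/existsP; exists (toff P id).
  by rewrite imset_toff imset_id eqxx andbT; apply: mor_id.
case: (@arg_maxnP _ P C (fun Q => #|'N_S(Q)|) CP) => Q.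
move=> /andP[sQS /existsP[f /andP[fF /eqP fPQ]]] maxQ.
have fF' : mor P f.
  have [injF _ _ _] := fsF.
  by have [Ef _ _ _] := injF P S sPS (subxx _) _ fF; rewrite /mor -Ef.
exists f, Q; split=> // R sRS cQR; apply: maxQ.
have [g gF gPR] := fconj_trans_mor sPS sQS sRS fF' fPQ cQR.
rewrite /C sRS; apply/existsP; exists (toff P g).
by rewrite imset_toff gPR eqxx andbT.
Qed.

End AutF.

(** * Extension of morphisms in a saturated fusion system *)

Section Saturated.

Variables (gT : finGroupType) (p : nat) (S : {group gT}) (F : homs gT).
Hypotheses (p_pr : prime p) (pS : p.-group S).
Hypothesis satF : saturated_fusion_system p S F.
Implicit Types N P Q R : {group gT}.

Local Notation mor := (mor S F).
Let fsF : is_fusion_system S F := proj1 satF.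

(** This is the extension axiom with [Nphi] as the group [N]. It suffices to take [z] in [S]: since
    [y] normalizes [P] and [f @: P = Q], such a [z] normalizes [Q]. *)
Lemma mor_ext P Q f : P \subset S -> Q \subset S -> mor P f -> f @: P = Q ->
  fully_centralized S F Q ->
  exists N g, [/\ P \subset N, N \subset S, mor N g, {in P, g =1 f}
    & forall y, y \in 'N_S(P) ->
        (exists2 z, z \in S & {in P, forall x, f (x ^ y) = f x ^ z}) -> y \in N].
Proof.
have [_ [_ extF]] := satF => sPS sQS fF fPQ cQ.
have [fM _ _] := mor_spec fsF sPS fF.
have EfQ : toff P f @: P = Q by rewrite imset_toff.
have NP y : reflect (y \in 'N_S(P) /\
    exists2 z, z \in 'N_S(Q) & {in P, forall x, f (x ^ y) = f x ^ z})
    (y \in Nphi S P (toff P f)).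
  rewrite [y \in Nphi _ _ _]inE EfQ; apply: (iffP andP).
    case=> yN /exists_inP[z zN /forall_inP yE]; split=> //; exists z => // x xP.
    have := yE x xP; rewrite !toffE ?memJ_norm //; first by move/eqP.
    by case/setIP: yN.
  case=> yN [z zN yE]; split=> //; apply/exists_inP; exists z => //.
  apply/forall_inP=> x xP; rewrite !toffE ?yE ?memJ_norm //.
  by case/setIP: yN.
have gN : group_set (Nphi S P (toff P f)).
  apply/group_setP; split.
    by apply/NP; split=> //; exists 1 => // x _; rewrite !conjg1.
  move=> y1 y2 /NP[y1N [z1 z1N y1E]] /NP[y2N [z2 z2N y2E]]; apply/NP.
  split; first exact: groupM.
  exists (z1 * z2); first exact: groupM.
  move=> x xP; rewrite !conjgM y2E ?y1E // memJ_norm //.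
  by case/setIP: y1N.
rewrite -EfQ in cQ.
have [g gF gE] := extF P sPS _ fF cQ.
have sNS : Group gN \subset S by apply/subsetP=> y /NP[/setIP[]].
have [injF _ _ _] := fsF.
have [Eg _ _ _] := injF (Group gN) S sNS (subxx _) _ gF.
exists (Group gN), g; split=> //.
- apply/subsetP=> y yP; apply/NP.
  split; first by rewrite inE (subsetP sPS) //= (subsetP (normG P)).
  have fyQ : f y \in Q by rewrite -fPQ imset_f.
  exists (f y); first by rewrite inE (subsetP sQS) //= (subsetP (normG Q)).
  by move=> x xP; apply: (morphJ (Morphism fM)).
- by rewrite Eg in gF.
- by move=> x xP; rewrite gE // toffE.
move=> y yN [z zS yE]; apply/NP; split=> //; exists z => //.
rewrite inE zS; apply/normP/eqP; rewrite eqEcard cardJg leqnn andbT.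
apply/subsetP=> _ /imsetP[_ /[1!(=^~ fPQ)] /imsetP[x xP ->] ->].
rewrite -yE // imset_f // memJ_norm //; by case/setIP: yN.
Qed.

(* By Sylow's theorem, composing [f] with an automorphism of [Q] makes it carry
   [AutS S P] into [AutS S Q]; it then extends to all of ['N_S(P)]. *)
Lemma mor_ext_norm P Q f : P \subset S -> Q \subset S -> mor P f -> f @: P = Q ->
  fully_normalized S F Q -> exists2 g, mor 'N_S(P) g & g @: P = Q.
Proof.
have [_ [sylF _]] := satF => sPS sQS fF fPQ nQ.
have [cQ sylQ] := sylF Q sQS nQ.
have [fM fI _] := mor_spec fsF sPS fF.
pose L := Group (group_set_AutF fsF sQS).
(* [X] is the transport of [AutS S P] to [Q] along [f]. *)
pose X := [set a in L | [exists g in 'N_S(P), [forall x in P, a (f x) == f (x ^ g)]]].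
have XP a : reflect (a \in L /\
    exists2 g, g \in 'N_S(P) & {in P, forall x, a (f x) = f (x ^ g)}) (a \in X).
  rewrite [a \in X]inE; apply: (iffP andP) => [[aL /exists_inP[g gN /forall_inP aE]]|].
    by split=> //; exists g => // x /aE/eqP.
  move=> [aQ [g gN aE]]; split=> //; apply/exists_inP; exists g => //.
  by apply/forall_inP=> x /aE/eqP.
have memJ x g : x \in P -> g \in 'N_S(P) -> x ^ g \in P.
  by move=> xP /setIP[_ gN]; rewrite memJ_norm.
have gX : group_set X.
  apply/group_setP; split.
    by apply/XP; split=> //; exists 1 => // x _; rewrite perm1 conjg1.
  move=> a b /XP[aL [g gN aE]] /XP[bL [h hN bE]]; apply/XP.
  split; first exact: groupM.
  exists (g * h) => [|x xP]; first exact: groupM.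
  by rewrite permM aE // bE ?conjgM // memJ.
have aX (a : {perm gT}) g n x : g \in 'N_S(P) ->
    {in P, forall x, a (f x) = f (x ^ g)} -> x \in P ->
    (a ^+ n) (f x) = f (x ^ (g ^+ n)).
  move=> gN aE; elim: n x => [|n IHn] x xP; first by rewrite perm1 conjg1.
  by rewrite !expgS permM aE // IHn ?memJ // conjgM.
(* An element of [X] induced by [g] is killed by the power [#|S|], because [g] is; so its order is a
   power of [p]. *)
have pX : p.-group (Group gX).
  apply/pgroupP=> q q_pr /(Cauchy q_pr)[a /= /XP[/(AutFP fsF _ sQS)[aQ _]]].
  move=> [g gN aE] oa; have [n Sn] := p_natP pS.
  have /eqP : a ^+ #|S| = 1.
    apply/permP=> y; rewrite perm1; have [yQ|y'Q] := boolP (y \in Q); last first.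
      by apply: out_Aut y'Q; apply: groupX.
    move: yQ; rewrite -fPQ => /imsetP[x xP ->].
    rewrite (aX _ g) // (_ : g ^+ _ = 1) ?conjg1 //.
    by apply/eqP; rewrite -order_dvdn order_dvdG //; case/setIP: gN.
  rewrite -order_dvdn oa Sn Euclid_dvdX // => /andP[].
  by rewrite (dvdn_prime2 q_pr p_pr).
have sXL : Group gX \subset L by apply/subsetP=> a /XP[].
have [b bL sXT] := Sylow_Jsub (Q := Group gX) (sylQ : p.-Sylow(L) _) sXL pX.
have /(AutFP fsF _ sQS)[bQ bF] := bL.
have bE y : y \in Q -> b y \in Q by move=> yQ; rewrite Aut_closed.
have fP x : x \in P -> f x \in Q by move=> xP; rewrite -fPQ imset_f.
have bfF : mor P (b \o f) by apply: (mor_comp fsF sPS sQS); rewrite ?fPQ.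
have bfPQ : (b \o f) @: P = Q by rewrite imset_comp fPQ; apply: imset_Aut.
have [N [g [sPN sNS gF gE extN]]] := mor_ext sPS sQS bfF bfPQ cQ.
exists g; last by rewrite -bfPQ; apply: eq_in_imset.
apply: (mor_res fsF sNS) gF; apply/subsetP=> y yN; apply: extN => //.
have [h [hF hQP fK hK]] := mor_inv fsF sPS sQS fF fPQ.
have hP z : z \in Q -> h z \in P by move=> zQ; rewrite -hQP imset_f.
have yhQP : (conjg^~ y \o h) @: Q = P.
  rewrite imset_comp hQP; apply: normP; case/setIP: yN => _; exact.
have yhF : mor Q (conjg^~ y \o h).
  apply: (mor_comp fsF sQS sPS hF); first by rewrite hQP.
  by apply: (mor_conj fsF sPS); case/setIP: yN.
have fyhQ : (f \o (conjg^~ y \o h)) @: Q = Q by rewrite imset_comp yhQP.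
have [|a aL aE] := mor_perm fsF sQS _ fyhQ.
  by apply: (mor_comp fsF sQS sPS yhF) => //; rewrite yhQP.
have aX' : a \in X.
  by apply/XP; split=> //; exists y => // x xP; rewrite aE ?fP //= fK.
have /AutSP[_ [z /setIP[zS _] zE]] : a ^ b \in AutS S Q.
  by apply: (subsetP sXT); rewrite /= memJ_conjg.
exists z => // x xP /=; rewrite -zE ?bE ?fP // permJ aE ?fP //=.
by rewrite fK.
Qed.

End Saturated.

(** * The induction step *)

Section InductionStep.

Variables (gT : finGroupType) (p : nat) (S : {group gT}) (G F : homs gT).
Hypotheses (p_pr : prime p) (pS : p.-group S).
Hypotheses (satG : saturated_fusion_system p S G).
Hypotheses (satF : saturated_fusion_system p S F).
Hypothesis sGF : forall P Q : {group gT},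
  P \subset S -> Q \subset S -> G P Q \subset F P Q.

Variables (P A B : {group gT}) (chi : gT -> gT).
Hypotheses (sPS : P \subset S) (nP : fully_normalized S F P).
Hypothesis IH : forall (R : {group gT}) f,
  R \subset S -> #|P| < #|R| -> mor S F R f -> mor S G R f.
Hypothesis nAP : A <| P.
Hypothesis autA : forall a, a \in Aut P -> p^'.-elt a ->
  {in A, forall x, a x = x} -> a = 1.
Hypothesis detA : forall (E : {group gT}) f g, E \subset S -> mor S F A g ->
  g @: A = E -> mor S F E f -> mor S G E f.
Hypotheses (chiG : mor S G P chi) (chiAB : chi @: A = B).
Hypothesis cB : fully_centralized S G B.

Implicit Types (N Q R : {group gT}) (a : {perm gT}).

Let fsG : is_fusion_system S G := proj1 satG.
Let fsF : is_fusion_system S F := proj1 satF.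

Lemma mor_sub Q f : Q \subset S -> mor S G Q f -> mor S F Q f.
Proof. by move=> sQS; apply: (subsetP (sGF sQS (subxx _))). Qed.

Let sAP : A \subset P := normal_sub nAP.
Let AP x : x \in A -> x \in P. Proof. exact: (subsetP sAP). Qed.
Let AJ x y : x \in A -> y \in P -> x ^ y \in A.
Proof. by move=> xA yP; rewrite memJ_norm // (subsetP (normal_norm nAP)). Qed.
Let chiF : mor S F P chi := mor_sub sPS chiG.

(* [psi] extends the [G]-morphism [chi \o phi^-1] from [phi @: A] to [B]: its
   extension domain contains [phi @: P] because [phi] and [chi] are defined on
   the whole of [P]. *)
Lemma mor_straighten phi : mor S F P phi ->
  exists N psi, [/\ N \subset S, mor S G N psi, phi @: P \subset N,
    {in A, forall x, psi (phi x) = chi x}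
    & forall c, c \in S -> {in A, forall x, commute (phi x) c} -> c \in N].
Proof.
move=> phiF; have sAS := subset_trans sAP sPS.
have [phiM _ sphiS] := mor_spec fsF sPS phiF.
have [chiM _ schiS] := mor_spec fsF sPS chiF.
have phiAF := mor_res fsF sPS sAP phiF.
have [E [phiAE sES _]] := mor_im fsF sAS phiAF.
have [h [hF hEA phiK hK]] := mor_inv fsF sAS sES phiAF phiAE.
have chiAF := mor_res fsF sPS sAP chiF.
have fF : mor S F E (chi \o h).
  by apply: (mor_comp fsF sES sAS hF) => //; rewrite hEA.
have fE : (chi \o h) @: E = B by rewrite imset_comp hEA.
have fG := detA sES phiAF phiAE fF.
have sBS : B \subset S.
  by rewrite -chiAB (subset_trans _ schiS) // imsetS.
have [N [g [_ sNS gG gE inN]]] := mor_ext satG sES sBS fG fE cB.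
exists N, g; split=> //.
- apply/subsetP=> _ /imsetP[u uP ->].
  have phiJ x : x \in P -> phi (x ^ u) = phi x ^ phi u.
    by move=> xP; apply: (morphJ (Morphism phiM)).
  apply: inN.
    rewrite inE (subsetP sphiS) ?imset_f //=; apply/normP/eqP.
    rewrite eqEcard cardJg leqnn andbT.
    apply/subsetP=> _ /imsetP[_ /[1!(=^~ phiAE)] /imsetP[x xA ->] ->].
    by rewrite -phiJ ?AP // imset_f ?AJ.
  exists (chi u); first by rewrite (subsetP schiS) ?imset_f.
  move=> _ /[1!(=^~ phiAE)] /imsetP[x xA ->] /=.
  rewrite -phiJ ?AP // !phiK ?AJ //.
  by apply: (morphJ (Morphism chiM)) => //; apply: AP.
- by move=> x xA; rewrite gE ?phiK -?phiAE ?imset_f //= phiK.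
move=> c cS cC; have cE x : x \in E -> x ^ c = x.
  rewrite -phiAE => /imsetP[y yA ->]; apply/conjg_fixP/commgP.
  exact: cC.
apply: inN; last by exists 1 => // x xE; rewrite cE ?conjg1.
rewrite inE cS; apply/normP/eqP; rewrite eqEcard cardJg leqnn andbT.
by apply/subsetP=> _ /imsetP[x xE ->]; rewrite cE.
Qed.

(** By [mor_straighten] and [mor_cancel], only such [phi] have to be shown to lie in [G]. *)
Definition agree phi := mor S F P phi /\ {in A, phi =1 chi}.

Lemma agree_chi : agree chi. Proof. by []. Qed.

(** Both [phi1 u] and [phi2 u] act on [B] as the transport along [chi] of conjugation by [u] on
    [A]. *)
Lemma agree_quot phi1 phi2 u : agree phi1 -> agree phi2 -> u \in P ->
  (phi1 u)^-1 * phi2 u \in 'C_S(B).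
Proof.
move=> [phi1F phi1A] [phi2F phi2A] uP.
have [phi1M _ sphi1S] := mor_spec fsF sPS phi1F.
have [phi2M _ sphi2S] := mor_spec fsF sPS phi2F.
rewrite inE groupM ?groupV ?(subsetP sphi1S _ (imset_f _ uP)) //=; last first.
  exact: (subsetP sphi2S _ (imset_f _ uP)).
apply/centP=> _ /[1!(=^~ chiAB)] /imsetP[x xA ->].
have x'A : x ^ u^-1 \in A by rewrite AJ ?groupV.
have J1 : phi1 ((x ^ u^-1) ^ u) = phi1 (x ^ u^-1) ^ phi1 u.
  by apply: (morphJ (Morphism phi1M)) => //; apply: AP.
have J2 : phi2 ((x ^ u^-1) ^ u) = phi2 (x ^ u^-1) ^ phi2 u.
  by apply: (morphJ (Morphism phi2M)) => //; apply: AP.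
move: J1 J2; rewrite conjgKV phi1A // phi1A // phi2A // phi2A // => J1 J2.
apply/commute_sym/commgP/conjg_fixP.
by rewrite {1}J1 conjgM conjgK -J2.
Qed.

Lemma agree_im phi1 phi2 : agree phi1 -> agree phi2 ->
  'C_S(B) \subset phi1 @: P -> phi2 @: P = phi1 @: P.
Proof.
move=> phi1P phi2P sCP.
have [[phi1F _] [phi2F _]] := (phi1P, phi2P).
have [Q1 [imQ1 _ cardQ1]] := mor_im fsF sPS phi1F.
have [Q2 [imQ2 _ cardQ2]] := mor_im fsF sPS phi2F.
apply/eqP; rewrite eqEcard imQ1 imQ2 cardQ1 cardQ2 leqnn andbT -imQ2.
apply/subsetP=> _ /imsetP[u uP ->].
rewrite -(mulKVg (phi1 u) (phi2 u)) groupM //= -imQ1 ?imset_f //.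
by apply: (subsetP sCP); apply: agree_quot.
Qed.

Let L := Group (group_set_AutF fsF sPS).
Let H := Group (group_set_AutF fsG sPS).

Let sTL : AutS S P \subset L. Proof. exact: AutS_sub_AutF. Qed.
Let sTH : AutS S P \subset H. Proof. exact: AutS_sub_AutF. Qed.
Let sHL : H \subset L.
Proof.
by apply/subsetP=> a; rewrite !inE => /andP[-> /(subsetP (sGF sPS sPS))].
Qed.
Let sylT : p.-Sylow(L) (AutS S P).
Proof. by have [_ [sylF _]] := satF; have [] := sylF P sPS nP. Qed.
Let cP : fully_centralized S F P.
Proof. by have [_ [sylF _]] := satF; have [] := sylF P sPS nP. Qed.

Definition cent_A := L :&: 'C(A | 'P).

Lemma cent_AP a : reflect (a \in L /\ {in A, forall x, a x = x}) (a \in cent_A).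
Proof.
rewrite in_setI; apply: (iffP andP) => [[aL /astabP aA] //|[aL aA]].
by split=> //; apply/astabP.
Qed.

(** An element of prime order other than [p] would be trivial by [autA]. *)
Lemma cent_A_pgroup : p.-group cent_A.
Proof.
apply/pgroupP=> q q_pr /(Cauchy q_pr)[a /cent_AP[/(AutFP fsF _ sPS)[aP _] aA] oa].
apply: contraLR (prime_gt1 q_pr) => qp; rewrite -oa (autA aP) ?order1 //.
by rewrite /p_elt oa pnatE.
Qed.

(** The hypothesis puts [y] in the extension domain of [a], so [a] extends in [F] to a subgroup
    larger than [P], where [IH] puts the extension in [G]. *)
Lemma Aut_ext_in a y : a \in L -> y \in 'N_S(P) -> y \notin P ->
  (exists2 z, z \in S & {in P, forall x, a (x ^ y) = a x ^ z}) -> a \in H.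
Proof.
move=> /(AutFP fsF _ sPS)[aP aF] yN y'P ay.
have [N [g [sPN sNS gF gE inN]]] :=
  mor_ext satF sPS sPS aF (imset_Aut aP) cP.
apply/(AutFP fsG _ sPS); split=> //.
apply: mor_eq gE (mor_res fsG sNS sPN _).
apply: IH gF => //; apply: proper_card; apply/properP; split=> //.
by exists y => //; apply: inN.
Qed.

(* If [P] contains ['C_S(B)], the automorphism [chi^-1 \o phi] of [P] lies in
   the [p]-group [cent_A], and turns out to be inner. *)
Lemma agree_in_G_cent phi : agree phi -> 'C_S(B) \subset chi @: P ->
  mor S G P phi.
Proof.
move=> phiP sCP; have [phiF phiA] := phiP.
have [Q [imQ sQS _]] := mor_im fsG sPS chiG.
have [h [hG hQP chiK hK]] := mor_inv fsG sPS sQS chiG imQ.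
have phiQ : phi @: P = Q by rewrite (agree_im agree_chi phiP sCP).
have hF := mor_sub sQS hG.
have [||a aL aE] := @mor_perm _ _ _ fsF P (h \o phi) sPS.
- by apply: (mor_comp fsF sPS sQS phiF) => //; rewrite phiQ.
- by rewrite imset_comp phiQ.
have aX : a \in cent_A.
  by apply/cent_AP; split=> // x xA; rewrite aE ?AP //= phiA // chiK ?AP.
have sXL : cent_A \subset L by apply: subsetIl.
have [b bL sXT] := Sylow_Jsub (sylT : p.-Sylow(L) [group of AutS S P]) sXL cent_A_pgroup.
have /AutSP[_ [y yN yE]] : a ^ b \in AutS S P.
  by apply: (subsetP sXT); rewrite /= memJ_conjg.
have /(AutFP fsF _ sPS)[bP bF] := bL.
have bimP := imset_Aut bP.
(* As [y] centralizes [b @: A], straightening [b] by [psi] sends [y] into ['C_S(B)], which lies in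
   [chi @: P = psi @: P]; injectivity of [psi] brings [y] back to [P]. *)
have yP : y \in P.
  have [N [psi [sNS psiG sbN psiA inN]]] := mor_straighten bF.
  have sPN : P \subset N by rewrite bimP in sbN.
  have psiF := mor_sub sNS psiG.
  have [psiM psiI spsiS] := mor_spec fsG sNS psiG.
  have psibP : agree (psi \o b).
    split; last by move=> x xA; apply: psiA.
    by apply: (mor_comp fsF sPS sNS bF).
  have cby x : x \in A -> commute (b x) y.
    move=> xA; apply/commgP/conjg_fixP.
    by rewrite -yE ?permJ ?aE ?Aut_closed ?AP //= phiA // chiK ?AP.
  have yN' : y \in N by apply: inN => //; case/setIP: yN.
  have : psi y \in psi @: P.
    have := agree_im agree_chi psibP sCP; rewrite imset_comp bimP => ->.
    apply: (subsetP sCP); rewrite inE (subsetP spsiS) ?imset_f //=.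
    apply/centP=> _ /[1!(=^~ chiAB)] /imsetP[x xA ->].
    have bxN : b x \in N by rewrite (subsetP sPN) // Aut_closed ?AP.
    by rewrite -psiA // /commute -!psiM // cby.
  case/imsetP=> x xP /psiI -> //; exact: (subsetP sPN).
(* Undoing the conjugation by [b], [a] is conjugation by [w], so [phi] is [chi] after an inner
   automorphism of [P]. *)
pose w := b^-1 y.
have wP : w \in P by rewrite Aut_closed ?groupV.
have aw x : x \in P -> a x = x ^ w.
  move=> xP; apply: (@perm_inj _ b).
  have [bM _ _] := mor_spec fsF sPS bF.
  have -> : b (x ^ w) = b x ^ b w by apply: (morphJ (Morphism bM)).
  by rewrite -permJ yE ?Aut_closed // permKV.
apply: mor_eq (mor_comp fsG sPS sPS (mor_conj fsG sPS (subsetP sPS _ wP)) _ chiG).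
  by move=> x xP /=; rewrite -aw // aE //= hK // -phiQ imset_f.
by apply/subsetP=> _ /imsetP[x xP ->]; rewrite groupJ.
Qed.

(** The inverse of [phi], up to an automorphism of [P], extends to [delta] on the normalizer of
    [phi @: P]. This normalizer is larger than [phi @: P], so [delta] is in [G] by [IH]. Take
    [a = delta \o phi] and [y = delta c], with [c] in ['C_S(B)] normalizing [phi @: P] but outside
    it. *)
Lemma agree_not_cent phi : agree phi -> ~~ ('C_S(B) \subset phi @: P) ->
  exists a y, [/\ a \in L, y \in 'N_S(P), y \notin P,
    {in A, forall x, commute (a x) y} & mor S G P phi <-> a \in H].
Proof.
move=> [phiF phiA] not_sCP.
have [phiM _ _] := mor_spec fsF sPS phiF.
have [Q [imQ sQS cardQ]] := mor_im fsF sPS phiF.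
have [h [hF hQP phiK hK]] := mor_inv fsF sPS sQS phiF imQ.
have phiAB : phi @: A = B by rewrite -chiAB; apply: eq_in_imset.
have nQC : Q \subset 'N('C_S(B)).
  apply: normsI; first exact: subset_trans (normG S).
  apply: subset_trans (cent_norm B).
  rewrite -imQ -phiAB; apply/subsetP=> _ /imsetP[u uP ->].
  rewrite inE; apply/subsetP=> _ /imsetP[_ /imsetP[x xA ->] ->].
  have <- : phi (x ^ u) = phi x ^ phi u.
    by apply: (morphJ (Morphism phiM)) => //; apply: AP.
  by rewrite imset_f ?AJ.
have sCS : 'C_S(B) \subset S by apply: subsetIl.
(* Normalizers grow in the [p]-group generated by [Q] and ['C_S(B)]; a normalizing element outside
   [Q] is corrected by a factor in [Q]. *)
have [c cC cNQ] : exists2 c, c \in 'C_S(B) & c \in 'N(Q) :\: Q.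
  have pM : p.-group (Q <*> 'C_S(B)) by rewrite (pgroupS _ pS) // join_subG sQS.
  have ltQM : Q \proper Q <*> 'C_S(B).
    by rewrite properE joing_subl join_subG subxx -imQ.
  have /properP[_ [y /setIP[yM yN] y'Q]] :=
    nilpotent_proper_norm (pgroup_nil pM) ltQM.
  move: yM; rewrite /= norm_joinEl // => /mulsgP[q c qQ cC Dy].
  exists c => //; have -> : c = q^-1 * y by rewrite Dy mulKg.
  by rewrite inE !(groupMl _ (groupVr _)) ?y'Q // (subsetP (normG Q)).
move: cC cNQ => /setIP[cS cB'] /setDP[cN c'Q].
have cNS : c \in 'N_S(Q) by rewrite inE cS.
have sQN : Q \subset 'N_S(Q) by rewrite subsetI sQS normG.
have sNS : 'N_S(Q) \subset S by apply: subsetIl.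
have [delta deltaF imdelta] := mor_ext_norm p_pr pS satF sQS sPS hF hQP nP.
have deltaG : mor S G 'N_S(Q) delta.
  apply: (IH (R := 'N_S(Q)%G)) deltaF => //; rewrite -cardQ proper_card //.
  by apply/properP; split=> //; exists c.
have [deltaM deltaI sdeltaS] := mor_spec fsF sNS deltaF.
have phiQ x : x \in P -> phi x \in Q by move=> xP; rewrite -imQ imset_f.
have phiN x : x \in P -> phi x \in 'N_S(Q).
  by move=> xP; rewrite (subsetP sQN) ?phiQ.
have dpF : mor S F P (delta \o phi).
  by apply: (mor_comp fsF sPS sNS phiF) => //; rewrite imQ.
have [|a aL aE] := mor_perm fsF sPS dpF.
  by rewrite imset_comp imQ.
have /(AutFP fsF _ sPS)[aP _] := aL.
exists a, (delta c); split=> //.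
- rewrite inE (subsetP sdeltaS) ?imset_f //=; apply/normP/eqP.
  rewrite eqEcard cardJg leqnn andbT; apply/subsetP=> _ /imsetP[z zP ->].
  move: zP; rewrite -imdelta => /imsetP[x xQ ->].
  have -> : delta x ^ delta c = delta (x ^ c).
    by apply/esym/(morphJ (Morphism deltaM)) => //; apply: (subsetP sQN).
  rewrite imset_f //.
  by rewrite memJ_norm.
- rewrite -imdelta; apply: contra c'Q => /imsetP[x xQ].
  by move/deltaI=> -> //; apply: (subsetP sQN).
- move=> x xA; have xP := AP xA; rewrite aE //= /commute.
  rewrite -!deltaM ?phiN //; congr (delta _).
  by apply/esym/(centP cB'); rewrite -phiAB imset_f.
split=> [phiG|/(AutFP fsG _ sPS)[_ aG]].
  apply/(AutFP fsG _ sPS); split=> //.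
  apply: (@mor_eq _ _ _ _ (delta \o phi)) => [x xP|]; first by rewrite aE.
  by apply: (mor_comp fsG sPS sNS phiG) => //; rewrite imQ.
apply: (mor_cancel fsG sPS sNS deltaG phiM); first by rewrite imQ.
by apply: mor_eq aG => x /aE.
Qed.

(** [agree_not_cent] is applied to both [chi] and [phi]. Since [chi] is in [G], so is [a1], and
    [embed_conj] with the [p]-group [cent_A] gives [a1^-1 * a2] in [H]. *)
Lemma agree_in_G_not_cent phi : agree phi -> ~~ ('C_S(B) \subset chi @: P) ->
  mor S G P phi.
Proof.
move=> phiP not_sCchi.
have not_sCphi : ~~ ('C_S(B) \subset phi @: P).
  by apply: contra not_sCchi => sCP; rewrite (agree_im phiP agree_chi sCP).
have [a1 [y1 [a1L y1N y1'P ca1y1 a1G]]] := agree_not_cent agree_chi not_sCchi.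
have [a2 [y2 [a2L y2N y2'P ca2y2 a2G]]] := agree_not_cent phiP not_sCphi.
apply/a2G; have a1H : a1 \in H by apply/a1G.
(* An element [c] of ['C_S(P)] outside [P] acts trivially on [P], so [a2] extends over it and
   [Aut_ext_in] applies at once. *)
have [sCSP | /subsetPn[c /setIP[cS cP'] c'P]] := boolP ('C_S(P) \subset P); last first.
  apply: (Aut_ext_in a2L _ c'P); first by rewrite inE cS (subsetP (cent_sub _)).
  exists 1 => // x xP; rewrite conjg1; congr (a2 _).
  by apply/conjg_fixP/commgP/esym/(centP cP').
rewrite -(mulKVg a1 a2) groupM //.
pose I := (conj_aut P @* P)%G.
have memI y : y \in P -> conj_aut P y \in I.
  by move=> yP; rewrite mem_morphim // (subsetP (normG P)).
have conjE y : y \in 'N_S(P) -> {in P, forall x, conj_aut P y x = x ^ y}.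
  by move=> /setIP[_ yN] x xP; rewrite norm_conj_autE.
have nIH : H \subset 'N(I).
  apply/subsetP=> a /(AutFP fsG _ sPS)[aP aG].
  have [aM _ _] := mor_spec fsG sPS aG.
  rewrite inE; apply/subsetP=> _ /imsetP[_ /morphimP[y yN yP ->] ->].
  have ayP : a y \in P by rewrite Aut_closed.
  have PN z : z \in P -> z \in 'N_S(P).
    by move=> zP; rewrite inE (subsetP sPS) ?(subsetP (normG P)).
  suff -> : conj_aut P y ^ a = conj_aut P (a y) by apply: memI.
  apply: (@eq_Aut _ P); rewrite ?groupJ ?Aut_aut // => x xP.
  rewrite -{1}(permKV a x) permJ !conjE ?PN //.
    have -> : a (a^-1 x ^ y) = a (a^-1 x) ^ a y.
      by apply: (morphJ (Morphism aM)) => //; rewrite Aut_closed ?groupV.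
    by rewrite permKV.
  by rewrite Aut_closed ?groupV.
(* If [a] conjugates the action of [y] to that of [z], it extends over [y]; and [y] is outside [P]
   because [u] is not inner. *)
have embed u a : u \in AutS S P -> u \notin I -> a \in L ->
    u ^ a \in AutS S P -> a \in H.
  move=> /AutSP[uP [y yN uE]] u'I aL /AutSP[_ [z /setIP[zS _] zE]].
  have /(AutFP fsF _ sPS)[aP _] := aL.
  apply: (Aut_ext_in aL yN); last first.
    by exists z => // x xP; rewrite -uE // -zE ?Aut_closed // permJ.
  apply: contra u'I => yP; suff -> : u = conj_aut P y by apply: memI.
  by apply: (@eq_Aut _ P) => // [|x xP]; rewrite ?Aut_aut // conjE ?uE.
(* If [y] acted as [w] in [P], then [y * w^-1] would be in ['C_S(P)], hence in [P]. *)
have not_inn y : y \in 'N_S(P) -> y \notin P -> conj_aut P y \notin I.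
  move=> yN; apply: contra => /morphimP[w wN wP Eyw].
  rewrite -(groupMr _ (groupVr wP)); apply: (subsetP sCSP).
  have /setIP[yS _] := yN.
  rewrite inE groupM ?groupV ?(subsetP sPS w) //=; apply/centP=> x xP.
  apply/commute_sym/commgP/conjg_fixP.
  rewrite conjgM -(conjE y) // Eyw norm_conj_autE // conjgK //.
have in_conj a y : a \in L -> y \in 'N_S(P) ->
    {in A, forall x, commute (a x) y} -> conj_aut P y \in cent_A :^ a.
  move=> aL yN cay; have /(AutFP fsF _ sPS)[aP _] := aL.
  rewrite mem_conjg; apply/cent_AP; split.
    by rewrite groupJ ?groupV // (subsetP sTL) ?conj_aut_AutS.
  move=> x xA; have axP : a x \in P by rewrite Aut_closed ?AP.
  rewrite -{1}(permK a x) permJ conjE //; apply/(canLR (permK a)).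
  by apply/conjg_fixP/commgP/cay.
apply: (@embed_conj _ p L H [group of AutS S P] I sHL sTH sylT nIH embed
  [group of cent_A] a1 a2 (conj_aut P y1) (conj_aut P y2)) => //.
- exact: subsetIl.
- exact: cent_A_pgroup.
- exact: conj_aut_AutS.
- exact: not_inn.
- exact: conj_aut_AutS.
- exact: not_inn.
- exact: in_conj.
exact: in_conj.
Qed.

Lemma mor_step phi : mor S F P phi -> mor S G P phi.
Proof.
move=> phiF; have [phiM _ _] := mor_spec fsF sPS phiF.
have [N [psi [sNS psiG sphiN psiA _]]] := mor_straighten phiF.
apply: (mor_cancel fsG sPS sNS psiG phiM sphiN).
have psiphi : agree (psi \o phi).
  split; last exact: psiA.
  exact: (mor_comp fsF sPS sNS phiF sphiN (mor_sub sNS psiG)).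
have [|] := boolP ('C_S(B) \subset chi @: P).
  exact: agree_in_G_cent.
exact: agree_in_G_not_cent.
Qed.

End InductionStep.

(** * Small abelian subgroups and the downward induction *)

Section SmallAbelian.

Variables (gT : finGroupType) (p : nat) (S : {group gT}) (F : homs gT).
Hypothesis fsF : is_fusion_system S F.

Lemma small_abelian_im (A B : {group gT}) f :
  A \subset S -> mor S F A f -> f @: A = B ->
  (if p == 2 then abelian A && (exponent A <= 4) else p.-abelem A) ->
  (if p == 2 then abelian B && (exponent B <= 4) else p.-abelem B).
Proof.
move=> sAS fF fAB; have [fM _ _] := mor_spec fsF sAS fF.
have <- : Morphism fM @* A = B by rewrite morphimEdom.
case: eqP => _; last exact: morphim_abelem.
case/andP=> cAA eA; rewrite morphim_abelian //=.
apply: leq_trans eA; apply: dvdn_leq; first exact: exponent_gt0.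
exact: exponent_morphim.
Qed.

End SmallAbelian.

Theorem theorem2 (gT : finGroupType) (p : nat) (S : {group gT})
  (G F : homs gT) :
  prime p -> p.-group S ->
  saturated_fusion_system p S G -> saturated_fusion_system p S F ->
  (forall P Q : {group gT}, P \subset S -> Q \subset S -> G P Q \subset F P Q) ->
  (forall A B : {group gT}, A \subset S -> B \subset S ->
     (if p == 2 then abelian A && (exponent A <= 4) else p.-abelem A) ->
     (if p == 2 then abelian B && (exponent B <= 4) else p.-abelem B) ->
     G A B = F A B) ->
  forall P Q : {group gT}, P \subset S -> Q \subset S -> G P Q = F P Q.
Proof.
move=> p_pr pS satG satF sGF eqGF P Q sPS sQS.
have [fsG fsF] := (proj1 satG, proj1 satF).
(* The bound [n] on [#|S| - #|R|] makes this a downward induction on [#|R|]. *)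
suff morGF n (R : {group gT}) f : #|S| - #|R| < n -> R \subset S ->
    mor S F R f -> mor S G R f.
  apply/eqP; rewrite eqEsubset sGF //; apply/subsetP=> f fF.
  have [injF _ _ _] := fsF.
  have [Ef _ _ sfQ] := injF P Q sPS sQS f fF.
  rewrite Ef; apply: (hom_cod fsG sPS (subxx S) sQS _ sfQ).
  apply: (morGF (#|S| - #|P|).+1) => //.
  have sfS := subset_trans sfQ sQS.
  by rewrite Ef in fF; apply: (hom_cod fsF sPS sQS (subxx S) fF sfS).
elim: n R f => // n IHn R phi ltRn sRS phiF.
have [f [R0 [sR0S fF fR nR0]]] := exists_fully_normalized fsF sRS.
have cardR : #|R0| = #|R|.
  by rewrite -fR card_in_imset //; case: (mor_spec fsF sRS fF).
have [A [nAR0 smallA autA]] := exists_small_abelian_normal p_pr (pgroupS sR0S pS).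
have sAS := subset_trans (normal_sub nAR0) sR0S.
have [g [B [sBS gG gAB nB]]] := exists_fully_normalized fsG sAS.
have [chi chiG chiAB] := mor_ext_norm p_pr pS satG sAS sBS gG gAB nB.
have cB : fully_centralized S G B.
  by have [_ [sylG _]] := satG; have [] := sylG B sBS nB.
(* Normality of [A] in [R0] lets [chi], defined on the normalizer of [A], restrict to [R0]. *)
have sR0N : R0 \subset 'N_S(A)%G by rewrite subsetI sR0S normal_norm.
have chiR0 : mor S G R0 chi.
  by apply: (mor_res fsG _ sR0N chiG); apply: subsetIl.
have step psi : mor S F R0 psi -> mor S G R0 psi.
  apply: (mor_step p_pr pS satG satF sGF sR0S nR0 _ nAR0 autA _ chiR0 chiAB cB).
    move=> T h sTS ltT hF; apply: IHn => //; rewrite ltnS in ltRn.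
    apply: leq_trans ltRn.
    by rewrite ltn_sub2l -?cardR // (leq_trans ltT) ?subset_leq_card.
  (* The codomain [S] need not be small, so [eqGF] is applied with codomain the image [E'] of
     [h]. *)
  move=> E h k sES kF kAE hF; have [E' [hE sE'S _]] := mor_im fsF sES hF.
  have smallE := small_abelian_im fsF sAS kF kAE smallA.
  have smallE' := small_abelian_im fsF sES hF hE smallE.
  have: toff E h \in F E E'.
    by apply: (hom_cod fsF sES (subxx S) sE'S hF); rewrite hE.
  rewrite -eqGF // => hG; apply: (hom_cod fsG sES sE'S (subxx S) hG).
  by rewrite hE.
(* To pass from [R0] back to [R], write [phi] as [(phi \o h) \o k]: both [h] and [phi \o h] start at
   [R0], so [step] puts them in [G], and [k] is the inverse of [h] in [G]. *)
have [h [hF hR fK hK]] := mor_inv fsF sRS sR0S fF fR.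
have [k [kG _ hkK _]] := mor_inv fsG sR0S sRS (step h hF) hR.
have phihG : mor S G R0 (phi \o h).
  by apply/step/(mor_comp fsF sR0S sRS hF) => //; rewrite hR.
apply: mor_eq (mor_comp fsG sRS sR0S kG _ phihG) => [x xR /=|].
  by rewrite -{1}(fK x xR) hkK ?fK // -fR imset_f.
apply/subsetP=> _ /imsetP[x xR ->].
by rewrite -(fK x xR) hkK -fR imset_f.
Qed.
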